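(* Let $A$ be an abelian group which is a direct sum of cyclic groups. Then $\mathfrak{J}(\mathrm{End} A)$ is closed in $\mathrm{End} A$ (with respect to the finite topology) if and only if every primary component of $A$ is bounded.
   Context: $\mathrm{End} A$ is the ring of endomorphisms of the abelian group $A$ and $\mathfrak{J}$ denotes the Jacobson radical. The finite topology on $\mathrm{End} A$ has as a fundamental system of neighborhoods of zero the sets $T(K)=\{\alpha\in \mathrm{End} A\mid \alpha K=0\}$, $K$ running over all finite subsets of $A$. The primary components of $A$ are the $p$-primary components ($p$ prime) of its torsion subgroup. An abelian group $B$ is called bounded if there is a non-zero natural number $n$ with $nb=0$ for all $b\in B$. *)

(* Defs.v *)
From HB Require Import structures.
From mathcomp Require Import all_boot all_order all_algebra.
From mathcomp Require Import boolp classical_sets functions cardinality fsbigop.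
From mathcomp Require Import filter topology.

Set Implicit Arguments.
Unset Strict Implicit.
Unset Printing Implicit Defensive.

Import GRing.Theory.
Local Open Scope classical_set_scope.
Local Open Scope ring_scope.

Definition endo (A : zmodType) : Type := {additive A -> A}.

Lemma endoP (A : zmodType) (f g : endo A) : f =1 g -> f = g.
Proof.
move=> fg; have {fg} : f = g :> (A -> A) by apply/funext.
case: f g => [f [[cf]]] [g [[cg]]] /= e.
by case: _ / e in cg *; rewrite (Prop_irrelevance cf cg).
Qed.

HB.instance Definition _ (A : zmodType) := gen_eqMixin (endo A).
HB.instance Definition _ (A : zmodType) := gen_choiceMixin (endo A).

Definition endo0 (A : zmodType) : endo A := (\0 : {additive A -> A}).
Definition endo_opp (A : zmodType) (f : endo A) : endo A :=
  (\- f : {additive A -> A}).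
Definition endo_add (A : zmodType) (f g : endo A) : endo A :=
  (f \+ g : {additive A -> A}).
Definition endo1 (A : zmodType) : endo A := (idfun : {additive A -> A}).
Definition endo_mul (A : zmodType) (f g : endo A) : endo A :=
  (f \o g : {additive A -> A}).

Lemma endo_addA (A : zmodType) : associative (@endo_add A).
Proof. by move=> f g h; apply: endoP => x /=; rewrite addrA. Qed.
Lemma endo_addC (A : zmodType) : commutative (@endo_add A).
Proof. by move=> f g; apply: endoP => x /=; rewrite addrC. Qed.
Lemma endo_add0 (A : zmodType) : left_id (endo0 A) (@endo_add A).
Proof. by move=> f; apply: endoP => x /=; rewrite add0r. Qed.
Lemma endo_addN (A : zmodType) :
  left_inverse (endo0 A) (@endo_opp A) (@endo_add A).
Proof. by move=> f; apply: endoP => x /=; rewrite addNr. Qed.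

HB.instance Definition _ (A : zmodType) := GRing.isZmodule.Build (endo A)
  (@endo_addA A) (@endo_addC A) (@endo_add0 A) (@endo_addN A).

Lemma endo_mulA (A : zmodType) : associative (@endo_mul A).
Proof. by move=> f g h; apply: endoP. Qed.
Lemma endo_mul1 (A : zmodType) : left_id (endo1 A) (@endo_mul A).
Proof. by move=> f; apply: endoP. Qed.
Lemma endo_mulr1 (A : zmodType) : right_id (endo1 A) (@endo_mul A).
Proof. by move=> f; apply: endoP. Qed.
Lemma endo_mulDl (A : zmodType) : left_distributive (@endo_mul A) +%R.
Proof. by move=> f g h; apply: endoP. Qed.
Lemma endo_mulDr (A : zmodType) : right_distributive (@endo_mul A) +%R.
Proof. by move=> f g h; apply: endoP => x /=; rewrite raddfD. Qed.

(* Only a pzRingType: the endomorphism ring of the trivial group is zero. *)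
HB.instance Definition _ (A : zmodType) := GRing.Zmodule_isPzRing.Build (endo A)
  (@endo_mulA A) (@endo_mul1 A) (@endo_mulr1 A) (@endo_mulDl A) (@endo_mulDr A).

Definition annihilator (A : zmodType) (K : set A) : set (endo A) :=
  [set f | forall a, K a -> f a = 0].

(* The finite topology is translation invariant: the neighborhoods of f are
   the supersets of the f + annihilator K for finite K. *)
Definition finite_nbhs (A : zmodType) (f : endo A) : set_system (endo A) :=
  filter_from [set K : set A | finite_set K]
    (fun K => [set f + t | t in annihilator K]).

HB.instance Definition _ (A : zmodType) :=
  hasNbhs.Build (endo A) (@finite_nbhs A).

Lemma finite_nbhs_filter (A : zmodType) (f : endo A) : ProperFilter (nbhs f).
Proof.
apply: filter_from_proper; last first.
  by move=> K _; exists (f + 0); exists 0.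
apply: filter_from_filter; first by exists set0; exact: finite_set0.
move=> K L finK finL; exists (K `|` L); first by rewrite /= finite_setU.
by move=> _ [t tKL <-]; split; exists t => // a aK; apply: tKL;
  [left | right].
Qed.

Lemma finite_nbhs_singleton (A : zmodType) (f : endo A) (U : set (endo A)) :
  nbhs f U -> U f.
Proof. by case=> K _; apply; exists 0; rewrite ?addr0. Qed.

Lemma finite_nbhs_nbhs (A : zmodType) (f : endo A) (U : set (endo A)) :
  nbhs f U -> nbhs f (nbhs^~ U).
Proof.
case=> K finK KU; exists K => // _ [t tK <-].
exists K => // _ [s sK <-]; apply: KU; exists (t + s); last by rewrite addrA.
by move=> a aK /=; rewrite tK // sK // addr0.
Qed.

HB.instance Definition _ (A : zmodType) :=
  Nbhs_isNbhsTopological.Build (endo A) (@finite_nbhs_filter A)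
    (@finite_nbhs_singleton A) (@finite_nbhs_nbhs A).

Definition left_ideal (R : pzRingType) (I : set R) : Prop :=
  [/\ I 0, forall x y, I x -> I y -> I (x + y) &
      forall r x, I x -> I (r * x)].

Definition maximal_left_ideal (R : pzRingType) (M : set R) : Prop :=
  [/\ left_ideal M, M <> setT &
      forall I : set R, left_ideal I -> M `<=` I -> I = M \/ I = setT].

Definition jacobson_radical (R : pzRingType) : set R :=
  \bigcap_(M in [set M : set R | maximal_left_ideal M]) M.
Arguments jacobson_radical R : clear implicits.

(* The sum below is only meaningful for finitely supported b, whence the
   second condition. *)
Definition internal_direct_sum (A : zmodType) (I : choiceType)
    (B : I -> set A) : Prop :=
  forall a : A, exists! b : I -> A,
    [/\ forall i, B i (b i), finite_set [set i | b i <> 0] &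
        a = \sum_(i \in [set: I]) b i].

Definition cyclic_subgroup (A : zmodType) (B : set A) : Prop :=
  exists c : A, B = range (fun n : int => c *~ n).

Definition direct_sum_of_cyclics (A : zmodType) : Prop :=
  exists (I : choiceType) (B : I -> set A),
    (forall i, cyclic_subgroup (B i)) /\ internal_direct_sum B.

Definition primary_component (A : zmodType) (p : nat) : set A :=
  [set a | exists k : nat, a *+ (p ^ k)%N = 0].
Arguments primary_component A p : clear implicits.

Definition bounded_subgroup (A : zmodType) (B : set A) : Prop :=
  exists n : nat, (0 < n)%N /\ forall b, B b -> b *+ n = 0.

(* Main.v *)
Require Import Defs.
From mathcomp Require Import all_boot all_order all_algebra.
From mathcomp Require Import boolp classical_sets functions cardinality fsbigop.
From mathcomp Require Import filter topology.
From HB Require Import structures.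
From mathcomp Require Import zify ring.

(** Write an element x of A through its coordinates [pr i x], multiples of the
    generators [c i] of the cyclic summands; [o i] is the order of [c i], with
    [o i = 0] for an infinite cyclic summand.  An endomorphism lies in the
    radical J iff 1 - r f has a left inverse for every r ([jacobsonP]), and f
    lies in the closure of J iff on every finite set f agrees with some element
    of J ([closure_endoP]).

    Bounded components make J closed.  Let f be in the closure of J.  For every
    r and x, some endomorphism s sends x - r (f x) to x
    ([closure_pointwise_inverse]): f may be replaced at x by an element of J.
    In particular r (f x) = x forces x = 0, and this rigidity has two
    consequences.
    - All values of f are torsion ([closure_torsion]).  Otherwise some additive
      l : A -> int does not vanish at f x, and letting r run through the maps
      z |-> k (l z) x shows that x is divisible by integers too large for its
      infinite order coordinates.
    - f strictly raises the p-height of elements of order p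
      ([closure_socle_height]).  Indeed, if p^h (f y) is not divisible by
      p^(h+1), then f y has a coordinate outside p C in a summand C with p^(h+1)
      dividing its order, so f y can be mapped to any element killed by
      p^(h+1), for instance to y ([hom_of_height]).
    If the p-component is bounded, heights on it are bounded, so a power of f
    kills the elements of order p.  By induction on the order f is nilpotent at
    every torsion element, hence at every element.  So 1 - f is bijective with
    inverse the pointwise finite sum of the powers of f.  The closure of J is
    stable under left multiplication, so the same holds for all r f, and f is
    in J.

    Conversely, a p-component which is not bounded yields summands
    C_0, C_1, C_2, ... whose orders have strictly increasing p-parts
    p^(n_0), p^(n_1), ...  Let f send the generator of C_k to an element of
    order p^(n_k) in C_(k+1), and all other summands to zero.  The part of
    f supported on one summand is in J: it takes values in p A and is killed by
    a power of p, so that it generates a nil left ideal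
    ([pr_divisible_jacobson]).  Thus f is in the closure of J.  But
    x - f x = c_0 has no solution: the coordinate of x in C_(k+1) would be the
    image under f of its coordinate in C_k, and f preserves the property of
    having a nontrivial p-part, so no coordinate along the chain could
    vanish. *)

Set Implicit Arguments.
Unset Strict Implicit.
Unset Printing Implicit Defensive.

Import Order.TTheory GRing.Theory Num.Theory.
Local Open Scope classical_set_scope.
Local Open Scope ring_scope.

(** * The Jacobson radical and left inverses *)

Lemma left_ideal1 (R : pzRingType) (I : set R) :
  left_ideal I -> I 1 -> I = setT.
Proof.
case=> _ _ IM I1; apply/seteqP; split=> // x _.
by rewrite -[x]mulr1; exact: IM.
Qed.

(** Krull's theorem for left ideals.  The maximality principle used asks for
    the union of the empty chain to be admissible, so the property is imposed
    on the sets [X `|` L] instead of on ideals X containing L. *)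
Lemma left_ideal_sub_maximal (R : pzRingType) (L : set R) :
  left_ideal L -> ~ L 1 -> exists2 M, maximal_left_ideal M & L `<=` M.
Proof.
move=> Lid L1.
pose P (X : set R) := left_ideal (X `|` L) /\ ~ (X `|` L) 1.
have [F FP Ftot|X [[Xid X1] Xmax]] := @Zorn_bigcup R P.
  have E a (Y : set R) : F Y -> (Y `|` L) a -> (\bigcup_(X in F) X `|` L) a.
    by move=> FY [Ya|La]; [left; exists Y|right].
  split; last first.
    case=> [[Y FY Y1]|//]; have [_] := FP _ FY; apply; by left.
  have [L0 LD LM] := Lid; split; first by right.
  - move=> x y [[X FX Xx]|Lx] [[Y FY Yy]|Ly]; last by right; exact: LD.
    + have [XY|YX] := Ftot _ _ FX FY.
        have [[_ YD _] _] := FP _ FY.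
        by apply: (E _ Y) => //; apply: YD; left=> //; exact: XY.
      have [[_ XD _] _] := FP _ FX.
      by apply: (E _ X) => //; apply: XD; left=> //; exact: YX.
    + have [[_ XD _] _] := FP _ FX.
      by apply: (E _ X) => //; apply: XD; [left|right].
    + have [[_ YD _] _] := FP _ FY.
      by apply: (E _ Y) => //; apply: YD; [right|left].
  - move=> r x [[X FX Xx]|Lx]; last by right; exact: LM.
    have [[_ _ XM] _] := FP _ FX.
    by apply: (E _ X) => //; apply: XM; left.
exists (X `|` L); last by move=> x; right.
split=> // [XT|I Iid XI]; first by apply: X1; rewrite XT.
have [I1|I1] := pselect (I 1); first by right; exact: left_ideal1.
left; apply/seteqP; split=> //; apply: contrapT => IX.
have LI : I `|` L = I.
  by apply/seteqP; split=> [x [//|Lx]|x Ix]; [apply: XI; right|left].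
apply: (Xmax I); last by rewrite /P LI.
split=> [x Xx|IX']; first by apply: XI; left.
by apply: IX => x /IX' Xx; left.
Qed.

Lemma jacobson_left_ideal (R : pzRingType) : left_ideal (jacobson_radical R).
Proof.
split=> [M [[M0 _ _] _ _] //|x y Jx Jy M MM|r x Jx M MM].
  by have [[_ MD _] _ _] := MM; apply: MD; [exact: Jx|exact: Jy].
by have [[_ _ Mm] _ _] := MM; apply: Mm; exact: Jx.
Qed.

Lemma jacobson_left_inverse (R : pzRingType) (x : R) :
  jacobson_radical R x -> exists s, s * (1 - x) = 1.
Proof.
move=> Jx; pose L := [set s * (1 - x) | s in [set: R]].
have [[s _ sx]|L1] := pselect (L 1); first by exists s.
have Lid : left_ideal L.
  split; first by exists 0; rewrite ?mul0r.
  - by move=> _ _ [s _ <-] [t _ <-]; exists (s + t); rewrite ?mulrDl.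
  - by move=> r _ [s _ <-]; exists (r * s); rewrite ?mulrA.
have [M MM LM] := left_ideal_sub_maximal Lid L1.
have [Mid MT _] := MM; case: MT; apply: left_ideal1 => //.
have [_ MD _] := Mid; rewrite -(subrK x 1); apply: MD; last exact: Jx.
by apply: LM; exists 1; rewrite ?mul1r.
Qed.

(** If x is outside a maximal left ideal M, then M + R x is everything, so some
    1 - r x lies in M; a left inverse of it would put 1 in M. *)
Lemma jacobsonP (R : pzRingType) (x : R) :
  jacobson_radical R x <-> forall r, exists s, s * (1 - r * x) = 1.
Proof.
split=> [Jx r|xinv M MM].
  by apply: jacobson_left_inverse; have [_ _] := jacobson_left_ideal R; exact.
have [Mid MT Mmax] := MM; have [M0 MD Mm] := Mid; apply: contrapT => Mx.
pose I := [set y : R | exists2 m, M m & exists r, y = m + r * x].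
have Iid : left_ideal I.
  split; first by exists 0 => //; exists 0; rewrite mul0r addr0.
  - move=> _ _ [m Mm1 [r ->]] [m' Mm2 [r' ->]];
    exists (m + m'); first exact: MD.
    by exists (r + r'); rewrite mulrDl addrACA.
  - move=> t _ [m Mm1 [r ->]]; exists (t * m); first exact: Mm.
    by exists (t * r); rewrite mulrDr mulrA.
have MI : M `<=` I.
  by move=> m Mm1; exists m => //; exists 0; rewrite mul0r addr0.
have Ix : I x by exists 0 => //; exists 1; rewrite mul1r add0r.
have [IM|IT] := Mmax _ Iid MI; first by apply: Mx; rewrite -IM.
have [m Mm1 [r m1]] : I 1 by rewrite IT.
apply: MT; apply: left_ideal1 => //.
have [s <-] := xinv r; apply: Mm.
by rewrite m1 addrK.
Qed.

(** A left inverse s of 1 - x is 1 + s x, so it has itself a left inverse,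
    which must be 1 - x. *)
Lemma jacobson_right_inverse (R : pzRingType) (x : R) :
  jacobson_radical R x -> exists s, (1 - x) * s = 1.
Proof.
move=> Jx; have [s sx] := jacobson_left_inverse Jx; exists s.
have [t] := (jacobsonP x).1 Jx (- s).
have -> : 1 - - s * x = s by rewrite mulNr opprK -[1]sx mulrBr mulr1 subrK.
by move=> ts; rewrite -[1 - x]mul1r -{1}ts -(mulrA t) sx mulr1.
Qed.

Lemma nil_left_ideal_jacobson (R : pzRingType) (x : R) :
  (forall r, exists n, (r * x) ^+ n = 0) -> jacobson_radical R x.
Proof.
move=> nilx; apply/jacobsonP => r; have [n xn0] := nilx r.
exists (\sum_(i < n) (r * x) ^+ i).
have comm_sum : GRing.comm (1 - r * x) (\sum_(i < n) (r * x) ^+ i).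
  apply: commr_sum => i _; apply/commr_sym; apply: commrB; first exact: commr1.
  exact/commr_sym/commrX.
by rewrite -comm_sum -opprB mulNr -subrX1 xn0 sub0r opprK.
Qed.

(** * Endomorphisms and the finite topology *)

Lemma endoM (A : zmodType) (f g : endo A) x : (f * g) x = f (g x).
Proof. by []. Qed.

Lemma endo1E (A : zmodType) x : (1 : endo A) x = x.
Proof. by []. Qed.

Lemma endo0E (A : zmodType) x : (0 : endo A) x = 0.
Proof. by []. Qed.

Lemma endoD (A : zmodType) (f g : endo A) x : (f + g) x = f x + g x.
Proof. by []. Qed.

Lemma endoB (A : zmodType) (f g : endo A) x : (f - g) x = f x - g x.
Proof. by []. Qed.

Lemma endo_sum (A : zmodType) (I : Type) (s : seq I) (F : I -> endo A) x :
  (\sum_(i <- s) F i) x = \sum_(i <- s) F i x.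
Proof.
by elim: s => [|i s IHs]; rewrite ?big_nil // !big_cons endoD IHs.
Qed.

Lemma closure_endoP (A : zmodType) (J : set (endo A)) (f : endo A) :
  closure J f <->
  forall s : seq A, exists2 g, J g & forall a, a \in s -> g a = f a.
Proof.
split=> [clf s|clf U [K /finite_seqP[s ->] KU]].
  have [|g [Jg [t ts gE]]] := clf [set f + t | t in annihilator [set` s]].
    by exists [set` s]; first by apply/finite_seqP; exists s.
  by exists g => // a /ts; rewrite -gE endoD => ->; rewrite addr0.
have [g Jg gE] := clf s; exists g; split=> //; apply: KU.
exists (g - f); last by rewrite addrC subrK.
by move=> a /gE ga; rewrite [LHS]endoB ga subrr.
Qed.

Lemma bijective_endo_inv (A : zmodType) (f : endo A) :
  injective f -> (forall y, exists x, f x = y) -> exists s : endo A, s * f = 1.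
Proof.
move=> finj fsurj; have /choice[g fg] := fsurj.
have gD : zmod_morphism g by move=> x y; apply: finj; rewrite raddfB !fg.
exists (HB.pack_for (endo A) g (GRing.isZmodMorphism.Build _ _ g gD)).
by apply: endoP => x; rewrite endoM; apply: finj; rewrite fg.
Qed.

(** The inverse of 1 - f is the sum of all powers of f, which is finite at each
    point. *)
Lemma locally_nil_left_inverse (A : zmodType) (f : endo A) :
  (forall x, exists k, (f ^+ k) x = 0) -> exists s : endo A, s * (1 - f) = 1.
Proof.
move=> fnil; apply: bijective_endo_inv => [|y].
  apply: raddf_inj => x; rewrite endoB => /subr0_eq; rewrite endo1E => xf.
  have [k <-] := fnil x.
  by elim: k => [|k IHk]; rewrite ?expr0 // exprSr endoM -xf.
have [k kE] := fnil y; exists ((\sum_(i < k) f ^+ i) y).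
by rewrite -endoM -opprB mulNr -subrX1 opprB endoB kE subr0.
Qed.

(** * Torsion, orders and divisibility *)

Definition torsion (V : zmodType) (x : V) : Prop :=
  exists2 n : nat, (0 < n)%N & x *+ n = 0.

Lemma torsionD (V : zmodType) (x y : V) :
  torsion x -> torsion y -> torsion (x + y).
Proof.
move=> [m m0 xm] [n n0 yn]; exists (m * n)%N; first by rewrite muln_gt0 m0.
by rewrite mulrnDl mulrnA xm mul0rn add0r mulnC mulrnA yn mul0rn.
Qed.

Lemma torsion_sum (V : zmodType) (T : Type) (s : seq T) (F : T -> V) :
  (forall i, torsion (F i)) -> torsion (\sum_(i <- s) F i).
Proof.
move=> tF; apply: (big_ind (@torsion V)) => //; last exact: torsionD.
by exists 1%N.
Qed.

(** The annihilator of x in the integers is principal; the value o = 0 stands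
    for an element of infinite order. *)
Lemma int_order (V : zmodType) (x : V) :
  exists o : nat, forall m : int, x *~ m = 0 <-> (o %| m)%Z.
Proof.
have [xn|xn] := pselect (exists n : nat, (0 < n)%N && (x *+ n == 0));
  last first.
  exists 0%N => m; rewrite dvd0z; split=> [xm|/eqP->]; last by rewrite mulr0z.
  apply: contra_notT xn => m0; exists `|m|%N; rewrite absz_gt0 m0 /=.
  apply/eqP; case: m xm {m0} => n //; rewrite NegzE mulrNz => /eqP.
  by rewrite oppr_eq0 abszN => /eqP.
have [o /andP[o0 /eqP xo] omin] := ex_minnP xn; exists o => m.
have xq q : x *~ (q * o%:Z) = 0 by rewrite mulrC mulrzA -pmulrn xo mul0rz.
split=> [xm|/dvdzP[q ->]]; last exact: xq.
apply/dvdz_mod0P; have := divz_eq m o; set q := (m %/ o)%Z.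
have oZ : 0 < o%:Z by rewrite ltz_nat.
have := modz_ge0 m (lt0r_neq0 oZ); have := ltz_pmod m oZ.
case: (m %% o)%Z => // r ro _ mE.
have xr : x *+ r = 0 by move: xm; rewrite mE mulrzDr xq add0r -pmulrn.
case: r ro mE xr => [//|r] ro mE xr;
have := omin r.+1; rewrite xr eqxx => /(_ isT).
by rewrite leqNgt => /negP; case; move: ro; rewrite ltz_nat.
Qed.

Lemma dvdz_of_pfactor (p k d : nat) (m : int) : prime p ->
  (d %| (p ^ k)%N%:Z * m)%Z -> ((p ^ logn p d)%N %| m)%Z -> (d %| m)%Z.
Proof.
move=> pp; have [->|d0] := posnP d.
  rewrite !dvd0z mulf_eq0 => /orP[/eqP[]/eqP|//].
  by rewrite expn_eq0 (gtn_eqF (prime_gt0 pp)).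
have [u pu dE] := pfactor_coprime pp d0; rewrite {1 3}dE PoszM => ud pd.
have pNu n : coprimez u (p ^ n)%N by rewrite coprimezE coprimeXr // coprime_sym.
rewrite Gauss_dvdz // pd andbT -(Gauss_dvdzr _ (pNu k)).
by apply: dvdz_trans ud; exact: dvdz_mulr.
Qed.

(** * Coordinates in a direct sum of cyclic groups *)

(** The projections are packaged as endomorphisms of A, so that coordinates can
    be composed with the elements of the ring under study. *)
Record cyclic_decomposition (A : zmodType) (I : choiceType) (c : I -> A)
    (pr : I -> endo A) : Prop := CyclicDecomposition {
  prE : forall i x, exists m : int, pr i x = c i *~ m;
  pr_id : forall i, pr i (c i) = c i;
  pr_neq : forall i j, j <> i -> pr j (c i) = 0;
  pr_supp : forall x, exists s : seq I,
    [/\ uniq s, forall i, i \notin s -> pr i x = 0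
      & x = \sum_(i <- s) pr i x] }.

Lemma fsum_setT_seq (V : zmodType) (I : choiceType) (s : seq I) (F : I -> V) :
  uniq s -> (forall i, i \notin s -> F i = 0) ->
  \sum_(i \in [set: I]) F i = \sum_(i <- s) F i.
Proof.
move=> us F0; rewrite [RHS]fsbig_seq //; apply/esym/fsbig_widen => //.
by move=> i [_ /negP/F0].
Qed.

Lemma finite_suppP (V : zmodType) (I : choiceType) (F : I -> V) :
  finite_set [set i | F i <> 0] <->
  exists2 s : seq I, uniq s & forall i, i \notin s -> F i = 0.
Proof.
split=> [/finite_seqP[s sE]|[s _ F0]].
  exists (undup s); first exact: undup_uniq.
  move=> i; rewrite mem_undup; apply: contraNP => Fi.
  by have : [set i | F i <> 0] i by []; rewrite sE.
apply: (@sub_finite_set _ _ [set` s]); last by apply/finite_seqP; exists s.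
by move=> i Fi /=; apply: contra_notT Fi; exact: F0.
Qed.

Lemma common_supp (A : zmodType) (I : choiceType) (b b' : I -> A) :
  finite_set [set i | b i <> 0] -> finite_set [set i | b' i <> 0] ->
  exists2 s : seq I, uniq s &
    forall i, i \notin s -> b i = 0 /\ b' i = 0.
Proof.
move=> /finite_suppP[s _ b0] /finite_suppP[s' _ b0'].
exists (undup (s ++ s')); first exact: undup_uniq.
by move=> i; rewrite mem_undup mem_cat negb_or => /andP[/b0 -> /b0' ->].
Qed.

(** Uniqueness of the components makes them additive in the element, and
    computes the components of a generator. *)
Lemma direct_sum_of_cyclicsP (A : zmodType) : direct_sum_of_cyclics A ->
  exists (I : choiceType) (c : I -> A) (pr : I -> endo A),
    cyclic_decomposition c pr.
Proof.
case=> I [B [/choice[c Bc] dsB]]; exists I, c.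
have /choice[b bP] : forall a, exists b : I -> A,
    [/\ forall i, B i (b i), finite_set [set i | b i <> 0] &
        a = \sum_(i \in [set: I]) b i].
  by move=> a; have [b [bP _]] := dsB a; exists b.
have bu a b' : (forall i, B i (b' i)) -> finite_set [set i | b' i <> 0] ->
    a = \sum_(i \in [set: I]) b' i -> b a = b'.
  move=> b'B b'fin b'a; have [d [_ du]] := dsB a.
  by rewrite -(du (b a)) // (du b').
have BB i x y : B i x -> B i y -> B i (x - y).
  by rewrite Bc => -[m _ <-] [n _ <-]; exists (m - n); rewrite ?mulrzBr.
have bB i : zmod_morphism (fun x => b x i).
  move=> x y; have [xB xfin xE] := bP x; have [yB yfin yE] := bP y.
  have [s us s0] := common_supp xfin yfin.
  have -> // : b (x - y) = fun i => b x i - b y i.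
  apply: bu => [j||]; first exact: BB.
    by apply/finite_suppP; exists s => // j /s0[-> ->]; rewrite subr0.
  have S F : (forall i, i \notin s -> F i = 0) ->
    \sum_(i \in [set: I]) F i = \sum_(i <- s) F i :> A by exact: fsum_setT_seq.
  rewrite {1}xE {1}yE 2?S => [|j /s0[]//|j /s0[]//]; rewrite S ?sumrB //.
  by move=> j /s0[-> ->]; rewrite subr0.
pose pr i : endo A :=
  HB.pack_for {additive A -> A} (fun x => b x i)
    (GRing.isZmodMorphism.Build _ _ (fun x => b x i) (bB i)).
have bc i : b (c i) = fun j => if j == i then c i else 0.
  apply: bu => [j||].
  - rewrite Bc; case: eqP => [->|_]; first by exists 1; rewrite ?mulr1z.
    by exists 0; rewrite ?mulr0z.
  - apply/finite_suppP; exists [:: i] => // j; rewrite inE => /negPf -> //.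
  - rewrite (@fsum_setT_seq _ _ [:: i]) ?big_seq1 ?eqxx // => j.
    by rewrite inE => /negPf ->.
exists pr; split.
- move=> i x; have [xB _ _] := bP x; have := xB i; rewrite Bc => -[m _ mE].
  by exists m; rewrite mE.
- by move=> i; have := congr1 (@^~ i) (bc i); rewrite /= eqxx.
- move=> i j /eqP/negPf ji; have := congr1 (@^~ j) (bc i).
  by rewrite /= ji.
- move=> x; have [xB /finite_suppP[s us x0] xE] := bP x; exists s; split=> //.
  by rewrite {1}xE (@fsum_setT_seq _ _ s).
Qed.

Section Coordinates.
Variables (A : zmodType) (I : choiceType) (c : I -> A) (pr : I -> endo A).
Hypothesis dec : cyclic_decomposition c pr.

Lemma pr_pr i x : pr i (pr i x) = pr i x.
Proof. by have [m ->] := prE dec i x; rewrite raddfMz (pr_id dec). Qed.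

Lemma pr_pr0 i j x : j <> i -> pr j (pr i x) = 0.
Proof.
by move=> ji; have [m ->] := prE dec i x; rewrite raddfMz (pr_neq dec) ?mul0rz.
Qed.

Lemma pr_eq0 x : (forall i, pr i x = 0) -> x = 0.
Proof. by move=> x0; have [s [_ _ ->]] := pr_supp dec x; rewrite big1. Qed.

Lemma eq_endo_pr (f g : endo A) :
  (forall i x, f (pr i x) = g (pr i x)) -> f = g.
Proof.
move=> fg; apply: endoP => x; have [s [_ _ ->]] := pr_supp dec x.
by rewrite !raddf_sum; apply: eq_bigr => i _.
Qed.

Lemma pr_supp_seq (K : seq A) : exists s : seq I,
  uniq s /\ forall a, a \in K -> a = \sum_(i <- s) pr i a.
Proof.
have [S SP] := choice (pr_supp dec).
exists (undup (flatten (map S K))); split=> [|a aK]; first exact: undup_uniq.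
have [uS S0 {1}->] := SP a.
rewrite -(fsum_setT_seq uS S0); apply: fsum_setT_seq.
  exact: undup_uniq.
move=> i.
rewrite mem_undup => /flattenP si; apply: S0; apply/negP => Sai; apply: si.
by exists (S a) => //; apply: map_f.
Qed.

(** A homomorphism out of one cyclic summand, extended by zero.  Only the image
    y of the generator is given, since [c i *~ m] determines [y *~ m]. *)
Lemma coord_hom (Y : zmodType) (i : I) (y : Y) :
  (forall m : int, c i *~ m = 0 -> y *~ m = 0) ->
  exists h : {additive A -> Y}, forall x m, pr i x = c i *~ m -> h x = y *~ m.
Proof.
move=> cy; have /choice[m mP] := prE dec i.
have hE x n : pr i x = c i *~ n -> y *~ m x = y *~ n.
  rewrite mP => mn; apply/eqP; rewrite -subr_eq0 -mulrzBr; apply/eqP/cy.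
  by rewrite mulrzBr mn subrr.
have hB : zmod_morphism (fun x => y *~ m x).
  by move=> u v; rewrite -mulrzBr; apply: hE; rewrite raddfB !mP mulrzBr.
by exists (HB.pack_for {additive A -> Y} (fun x => y *~ m x)
    (GRing.isZmodMorphism.Build _ _ (fun x => y *~ m x) hB)).
Qed.

(** The images of the summands can be prescribed independently even when
    infinitely many of them are nonzero, since an element has only finitely
    many coordinates. *)
Lemma glue (T : I -> endo A) :
  exists f : endo A, forall i x, f (pr i x) = T i (pr i x).
Proof.
pose f x := \sum_(i \in [set: I]) T i (pr i x).
have fE s x : uniq s -> (forall i, i \notin s -> pr i x = 0) ->
    f x = \sum_(i <- s) T i (pr i x).
  by move=> us s0; apply: fsum_setT_seq => // i /s0 ->; rewrite raddf0.
have fB : zmod_morphism f.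
  move=> x y; have [s [us sE]] := pr_supp_seq [:: x; y].
  have s0 z : z = \sum_(i <- s) pr i z -> forall i, i \notin s -> pr i z = 0.
    move=> -> i si; rewrite raddf_sum big_seq big1 // => j js.
    by apply: pr_pr0 => ij; rewrite ij js in si.
  have x0 := s0 _ (sE x (mem_head _ _)).
  have y0 : forall i, i \notin s -> pr i y = 0.
    by apply/s0/sE; rewrite !inE eqxx orbT.
  rewrite !(@fE s) //.
    by rewrite -sumrB; apply: eq_bigr => i _; rewrite !raddfB.
  by move=> i si; rewrite raddfB x0 // y0 // subrr.
exists (HB.pack_for {additive A -> A} f (GRing.isZmodMorphism.Build _ _ f fB)).
move=> i x; apply: etrans (@fE [:: i] (pr i x) isT _) _.
  by move=> j; rewrite inE => /eqP; exact: pr_pr0.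
by rewrite big_seq1 pr_pr.
Qed.

Lemma nontorsion_functional z :
  ~ torsion z -> exists l : {additive A -> int}, l z <> 0.
Proof.
move=> zt.
have [i zit] : exists i, ~ torsion (pr i z).
  apply: contrapT => /forallNP zit; apply: zt.
  have [s [_ _ ->]] := pr_supp dec z.
  by apply: torsion_sum => i; apply: contrapT; exact: zit.
have [k zk] := prE dec i z; have [o oP] := int_order (c i).
have o0 : o = 0%N.
  apply/eqP; rewrite -leqn0 leqNgt; apply/negP => o0; apply: zit.
  by exists o => //; rewrite zk pmulrn -mulrzA; apply/oP/dvdz_mull.
have [|l lE] := @coord_hom int i 1.
  by move=> m /oP; rewrite o0 dvd0z => /eqP->.
exists l; rewrite (lE _ _ zk) intz => k0; apply: zit.
by rewrite zk k0; exists 1%N.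
Qed.

(** If p^h z is not divisible by p^(h+1), the same holds for one coordinate k c
    of z.  This forces p^(h+1) to divide the order of c and p not to divide k;
    hence that coordinate can be sent to any element killed by p^(h+1). *)
Lemma hom_of_height (p h : nat) z y : prime p ->
  (forall w, z *+ p ^ h <> w *+ p ^ h.+1) -> y *+ p ^ h.+1 = 0 ->
  exists r : endo A, r z = y.
Proof.
move=> pp zh yh.
have [i zi] : exists i, forall m, pr i z *+ p ^ h <> c i *~ m *+ p ^ h.+1.
  apply: contrapT => /forallNP zi.
  have /choice[m mP] : forall i, exists m,
      pr i z *+ p ^ h = c i *~ m *+ p ^ h.+1.
    by move=> i; have /existsNP[m /contrapT mE] := zi i; exists m.
  have [s [_ _ zE]] := pr_supp dec z; apply: (zh (\sum_(i <- s) c i *~ m i)).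
  by rewrite {1}zE -!sumrMnl; apply: eq_bigr.
have [k zk] := prE dec i z; have [o oP] := int_order (c i).
have zN m : ~~ (o %| k * (p ^ h)%:Z - m * (p ^ h.+1)%:Z)%Z.
  apply/negP => /oP; rewrite mulrzBr => /eqP; rewrite subr_eq0 => /eqP E.
  by apply: (zi m); rewrite zk !pmulrn -!mulrzA.
(* Otherwise gcd (p^(h+1), o) divides p^h, and a Bezout relation makes the
   coordinate of p^h z divisible by p^(h+1). *)
have po : (p ^ h.+1 %| o)%N.
  have [e eh gE] : exists2 e, (e <= h.+1)%N & gcdn (p ^ h.+1) o = (p ^ e)%N.
    by apply/dvdn_pfactor => //; exact: dvdn_gcdl.
  move: eh; rewrite leq_eqVlt => /predU1P[eh|].
    by rewrite -eh -gE dvdn_gcdr.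
  rewrite ltnS => eh.
  have [u [v uv]] := Bezoutz (p ^ h.+1)%N o.
  have /negP[] := zN (k * (p ^ (h - e))%:Z * u).
  have -> : (p ^ h)%:Z = (p ^ (h - e))%:Z * (p ^ e)%:Z.
    by rewrite -PoszM -expnD subnK.
  rewrite -gE -[Posz (gcdn _ _)]/(gcdz (p ^ h.+1)%N o) -uv.
  apply/dvdzP; exists (k * (p ^ (h - e))%:Z * v); ring.
have pk : coprimez k (p ^ h.+1)%N.
  rewrite coprimezE; apply: coprimeXr; rewrite coprime_sym prime_coprime //.
  apply/negP => pk; have /dvdzP[k' kE] : (p %| k)%Z by [].
  have /negP[] := zN k'; rewrite kE expnS PoszM -mulrA subrr //.
have /coprimezP[[u v] /= uv] := pk.
have yP t : y *~ (t * (p ^ h.+1)%N%:Z) = 0.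
  by rewrite mulrC mulrzA -pmulrn yh mul0rz.
(* The generator is sent to u y with u inverse to k modulo p^(h+1). *)
have [m|r rE] := @coord_hom A i (y *~ u).
  move=> /oP om; have /dvdzP[q ->] : ((p ^ h.+1)%N %| m)%Z.
    exact: dvdz_trans om.
  by rewrite -mulrzA mulrA yP.
exists r; rewrite (rE _ _ zk) -mulrzA -[RHS]mulr1z -uv mulrzDr.
by rewrite yP addr0.
Qed.

(** * Bounded components: the radical is closed *)

Section Closure.
Variables (f : endo A).
Hypothesis clf : closure (jacobson_radical (endo A)) f.

(** At the single point x the endomorphism f coincides with an element of the
    radical, for which [jacobsonP] provides s. *)
Lemma closure_pointwise_inverse (r : endo A) x :
  exists s : endo A, s (x - r (f x)) = x.
Proof.
have [g Jg gE] := (closure_endoP _ _).1 clf [:: x].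
have [s sP] := (jacobsonP g).1 Jg r; exists s.
by rewrite -gE ?mem_head // -[x in RHS]endo1E -sP.
Qed.

(** If f x had infinite order, x would be a multiple of 1 - k m for m <> 0 and
    every integer k, which is impossible for an element of infinite order. *)
Lemma closure_torsion x : torsion (f x).
Proof.
apply: contrapT => fxt.
have xt : ~ torsion x.
  by move=> [n n0 xn]; apply: fxt; exists n => //; rewrite -raddfMn xn raddf0.
have [l lx] := nontorsion_functional xt.
have [l' lfx] := nontorsion_functional fxt.
(* The factor 3 makes |1 - k (l' (f x))| larger than |l x|. *)
pose k := 3 * l x * l' (f x).
have kB : zmod_morphism (fun z => x *~ (k * l' z)).
  by move=> u v; rewrite raddfB mulrBr mulrzBr.
pose r : endo A := HB.pack_for {additive A -> A} (fun z => x *~ (k * l' z))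
  (GRing.isZmodMorphism.Build _ _ (fun z => x *~ (k * l' z)) kB).
have [s sE] := closure_pointwise_inverse r x.
have : l x = l (s x) * (1 - k * l' (f x)).
  rewrite -[in LHS]sE -[r (f x)]/(x *~ (k * l' (f x))) -{1}[x]mulr1z -mulrzBr.
  by rewrite !raddfMz mulrzz.
rewrite /k; move: (l x) (l' (f x)) (l (s x)) lx lfx => a b m a0 b0 E.
have mN0 : m <> 0 by move=> m0; apply: a0; rewrite E m0 mul0r.
have bb : 1 <= b * b by nia.
have EB : a = m * (1 - 3 * a * (b * b)) by rewrite {1}E; ring.
move: (b * b) bb EB => B B1 {E} EB.
have aB : 3 * `|a| <= `|3 * a * B|.
  by rewrite !normrM (gtr0_norm (_ : 0 < 3)) //; nia.
have mB : `|1 - 3 * a * B| <= `|a| by rewrite [in leRHS]EB normrM; nia.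
lia.
Qed.

(** Otherwise an endomorphism r sends f y back to y, so that y, and with it x,
    would vanish. *)
Lemma closure_socle_height (p h : nat) x y : prime p ->
  x *+ p = 0 -> x = y *+ p ^ h -> exists w, f x = w *+ p ^ h.+1.
Proof.
move=> pp xp xy; apply: contrapT => /forallNP fx.
have [r rE] : exists r : endo A, r (f y) = y.
  apply: (@hom_of_height p h) => // [w|]; last by rewrite expnSr mulrnA -xy.
  by rewrite -raddfMn -xy; exact: fx.
have [s] := closure_pointwise_inverse r y; rewrite rE subrr raddf0 => y0.
by apply: (fx 0); rewrite xy -y0 !mul0rn raddf0.
Qed.

(** With n a bound for the p-component, (f ^+ n) x = p^n w with w in this
    component; the order of w is a power of p dividing n, hence divides p^n. *)
Lemma closure_socle_nil (p : nat) : prime p ->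
  bounded_subgroup (primary_component A p) ->
  exists k, forall x, x *+ p = 0 -> (f ^+ k) x = 0.
Proof.
move=> pp [n [n0 nA]]; exists n => x xp.
have fp k : (f ^+ k) x *+ p = 0 by rewrite -raddfMn xp raddf0.
have fh k : exists w, (f ^+ k) x = w *+ p ^ k.
  elim: k => [|k [w wE]]; first by exists x; rewrite expr0 expn0.
  by rewrite exprS endoM; exact: closure_socle_height (fp k) wE.
have [w wE] := fh n; rewrite wE.
have pn : (logn p n <= n)%N by exact/ltnW/ltn_logl.
have wn : w *+ n = 0.
  by apply: nA; exists n.+1; rewrite expnSr mulrnA -wE.
have wpn : w *+ p ^ n.+1 = 0 by rewrite expnSr mulrnA -wE.
have [o oP] := int_order w.
have on : (o %| n)%N by have /oP : w *~ n = 0.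
have [e _ oE] : exists2 e, (e <= n.+1)%N & o = (p ^ e)%N.
  by apply/dvdn_pfactor => //; have /oP : w *~ (p ^ n.+1)%N = 0.
rewrite pmulrn; apply/oP; rewrite oE in on *; apply: dvdn_exp2l.
by apply: leq_trans pn; rewrite -pfactor_dvdn.
Qed.

Hypothesis bdd : forall p, prime p -> bounded_subgroup (primary_component A p).

(** An element z of order dividing n > 1 is handled by induction on n: for a
    prime p dividing n, the element z *+ (n / p) is killed by p, hence by a
    power f^k of f, and then f^k z has order dividing n / p. *)
Lemma closure_nil x : exists k, (f ^+ k) x = 0.
Proof.
have tor n : forall z, (0 < n)%N -> z *+ n = 0 -> exists k, (f ^+ k) z = 0.
  have [m] := ubnP n; elim: m n => // m IHm n nm z n0 zn.
  have [n1|n1] := leqP n 1%N.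
    have -> : z = 0.
      move: zn; rewrite (_ : n = 1%N) //;
      by apply/eqP; rewrite eqn_leq n1.
    by exists 0%N; rewrite raddf0.
  have pp := pdiv_prime n1; have pn := pdiv_dvd n.
  have [k kE] := closure_socle_nil pp (bdd pp).
  have [|||j jE] := IHm (n %/ pdiv n)%N _ ((f ^+ k) z).
  - by rewrite ltnS in nm; apply: leq_trans nm; rewrite ltn_Pdiv // prime_gt1.
  - by rewrite divn_gt0 ?pdiv_gt0 // dvdn_leq.
  - by rewrite -raddfMn kE // -mulrnA divnK.
  by exists (j + k)%N; rewrite exprD endoM.
have [n n0 fxn] := closure_torsion x; have [k kE] := tor n _ n0 fxn.
by exists k.+1; rewrite exprSr endoM.
Qed.

End Closure.

Lemma closed_jacobson_of_bounded :
  (forall p, prime p -> bounded_subgroup (primary_component A p)) ->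
  closed (jacobson_radical (endo A)).
Proof.
move=> bdd f clf; apply/jacobsonP => r.
apply/locally_nil_left_inverse/closure_nil => //.
apply/closure_endoP => s; have [g Jg gE] := (closure_endoP _ _).1 clf s.
exists (r * g); first by have [_ _] := jacobson_left_ideal (endo A); exact.
by move=> a /gE; rewrite !endoM => ->.
Qed.

(** * Unbounded components: the radical is not closed *)

(** For every r, the coordinate i of r (t (c i)) is (p m) c_i for some m.
    Therefore (r t)^(k+1) maps [c i] to (p m)^k r (t (c i)), which vanishes as
    soon as p^k kills t (c i). *)
Lemma pr_divisible_jacobson (p N : nat) (i : I) (t : endo A) (w : A) :
  (forall x, t x = t (pr i x)) -> t (c i) = w *+ p -> t (c i) *+ p ^ N = 0 ->
  jacobson_radical (endo A) t.
Proof.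
move=> tpr tw tN; apply: nil_left_ideal_jacobson => r; exists N.+1.
have upr k x : ((r * t) ^+ k.+1) x = ((r * t) ^+ k.+1) (pr i x).
  by rewrite exprSr !endoM tpr.
have [m mE] := prE dec i (r w).
have prt : pr i (r (t (c i))) = c i *~ (m * p%:Z).
  by rewrite tw !raddfMn mE mulrzA.
have uc k : ((r * t) ^+ k.+1) (c i) = r (t (c i)) *~ (m ^+ k * (p ^ k)%N%:Z).
  elim: k => [|k IHk]; first by rewrite expr1 expr0 expn0 mul1r mulr1z.
  rewrite exprSr endoM upr endoM prt raddfMz IHk -mulrzA; congr (_ *~ _).
  by rewrite exprSr expnSr PoszM; ring.
apply: endoP => x; rewrite upr; have [k ->] := prE dec i x.
rewrite raddfMz uc (mulrC (m ^+ N)) mulrzA -pmulrn -raddfMn tN raddf0.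
by rewrite !mul0rz.
Qed.

Section Unbounded.
Variables (o : I -> nat) (p : nat).
Hypothesis oP : forall i (m : int), c i *~ m = 0 <-> (o i %| m)%Z.
Hypothesis pp : prime p.

Lemma bounded_of_logn (N : nat) : (forall i, (logn p (o i) <= N)%N) ->
  bounded_subgroup (primary_component A p).
Proof.
move=> oN; exists (p ^ N)%N; split=> [|x [k xk]].
  by rewrite expn_gt0 prime_gt0.
apply: pr_eq0 => i; have [m mE] := prE dec i x.
rewrite raddfMn mE pmulrn -mulrzA; apply/oP/(@dvdz_of_pfactor p k) => //.
  rewrite mulrA dvdz_mulr // mulrC; apply/oP.
  by rewrite mulrzA -mE -pmulrn -raddfMn xk raddf0.
by rewrite dvdz_mull //; exact: dvdn_exp2l.
Qed.

(** The link of the chain: [c i] is sent to the multiple of [c j] whose order is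
    the p-part of [o i].  It lands in p A since the p-part of [o j] is strictly
    larger.  The last clause is the invariant carried along the chain: a
    coordinate whose p-part is nontrivial has an image of the same kind. *)
Lemma step_hom i j : (logn p (o i) < logn p (o j))%N ->
  exists h : endo A, [/\ forall x, h x = h (pr i x),
    forall x, exists m, h x = c j *~ m,
    jacobson_radical (endo A) h &
    forall m : int, ~ ((p ^ logn p (o i))%N %| m)%Z ->
      exists2 m', h (c i *~ m) = c j *~ m' & ~ ((p ^ logn p (o j))%N %| m')%Z].
Proof.
set a := logn p (o i); set b := logn p (o j) => ab.
have o0 : (0 < o j)%N.
  by rewrite lt0n; apply: contraTneq ab => o0; rewrite /b o0 logn0.
have [u pu oE] : exists2 u, coprime p u & o j = (u * p ^ b)%N.
  by have [u pu oE] := pfactor_coprime pp o0; exists u.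
pose q := (u * p ^ (b - a))%N.
have qa : (q * p ^ a)%N = o j by rewrite /q -mulnA -expnD subnK // ltnW.
have [m /oP om|h hE] := @coord_hom A i (c j *~ q).
  rewrite -mulrzA; apply/oP; rewrite -qa PoszM dvdz_mul //.
  by apply: dvdz_trans om; exact: pfactor_dvdnn.
have hpr x : h x = h (pr i x).
  by have [m mE] := prE dec i x; rewrite (hE _ _ mE) (hE (pr i x) m) // pr_pr.
have hc m : h (c i *~ m) = c j *~ (q%:Z * m).
  by rewrite (hE _ m) ?mulrzA // raddfMz (pr_id dec).
exists h; split=> //.
- by move=> x; have [m mE] := prE dec i x; exists (q%:Z * m); rewrite hpr mE hc.
- apply: (@pr_divisible_jacobson p a i h (c j *+ (u * p ^ (b - a.+1)))) => //.
    rewrite -[c i]mulr1z hc mulr1 -pmulrn -mulrnA -mulnA -expnSr /q.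
    by rewrite subnSK.
  rewrite -[c i]mulr1z hc mulr1 -pmulrn -mulrnA qa pmulrn.
  by apply/oP; exact: dvdnn.
- move=> m am; exists (q%:Z * m); first exact: hc.
  move=> bm; apply: am; rewrite -(@Gauss_dvdzr _ u%:Z); last first.
    by rewrite coprimezE coprimeXl.
  have pba : (p ^ (b - a))%N%:Z != 0.
    by rewrite eqz_nat -lt0n expn_gt0 prime_gt0.
  rewrite -(dvdz_mul2l pba) -PoszM -expnD subnK ?(ltnW ab) // mulrA -PoszM.
  by rewrite mulnC.
Qed.

(** Otherwise the sum f of the links along an infinite chain of summands is in
    the closure of the radical, while 1 - f is not surjective. *)
Lemma closed_jacobson_logn_bounded :
  closed (jacobson_radical (endo A)) ->
  exists N : nat, forall i, (logn p (o i) <= N)%N.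
Proof.
move=> clJ; apply: contrapT => /forallNP unb.
have /choice[next nextP] : forall i, exists j, (logn p (o i) < logn p (o j))%N.
  move=> i; have /existsNP[j /negP] := unb (logn p (o i)).
  by rewrite -ltnNge; exists j.
have /existsNP[i0 _] := unb 0%N.
have /choice[h hP] := fun i => step_hom (nextP i).
(* The first link of the chain is already the image of an index under next, so
   that its order has a nontrivial p-part. *)
pose e k := iter k.+1 next i0.
have e_mono k l : (k < l)%N -> (logn p (o (e k)) < logn p (o (e l)))%N.
  elim: l => // l IHl; rewrite ltnS leq_eqVlt.
  by move=> /predU1P[->|/IHl /ltn_trans->].
have e_inj : injective e.
  move=> k l kl; have [/e_mono|/e_mono|//] := ltngtP k l; by rewrite kl ltnn.
(* The choice function next need not be injective; killing the summands off the
   chain makes sure that each coordinate of f x along it has a single source. *)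
pose T i : endo A := if `[< exists k, i = e k >] then h i else 0.
have Tpr i x : T i x = T i (pr i x).
  by rewrite /T; case: asboolP => // _; have [hpr _ _ _] := hP i.
have TJ i : jacobson_radical (endo A) (T i).
  rewrite /T; case: asboolP => [_|_]; first by have [_ _ hJ _] := hP i.
  by have [J0 _ _] := jacobson_left_ideal (endo A).
have Te k x : T (e k) x = h (e k) x.
  by rewrite /T; case: asboolP => // -[]; exists k.
have prT i j x : (forall k, j = e k -> i <> next j) -> pr i (T j x) = 0.
  rewrite /T; case: asboolP => [[k jk]|_] ij; last by rewrite endo0E raddf0.
  have [_ hc _ _] := hP j; have [m ->] := hc x.
  rewrite raddfMz (pr_neq dec) ?mul0rz //; exact: ij jk.
have [f fT] := glue T.
have Jf : jacobson_radical (endo A) f.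
  apply: clJ; apply/closure_endoP => K; have [s [us sK]] := pr_supp_seq K.
  (* On a finite set f agrees with finitely many of the T i. *)
  exists (\sum_(i <- s) T i).
    have [J0 JD _] := jacobson_left_ideal (endo A).
    by apply: (big_ind (jacobson_radical (endo A))).
  move=> a /sK aE; rewrite endo_sum [in RHS]aE raddf_sum.
  by apply: eq_bigr => i _; rewrite fT -Tpr.
have [s sP] := jacobson_right_inverse Jf; pose x := s (c (e 0%N)).
have xE : x = c (e 0%N) + f x.
  by apply/eqP; rewrite -subr_eq; apply/eqP; rewrite -[RHS]endo1E -sP.
have pr0f : pr (e 0%N) (f x) = 0.
  rewrite -endoM; have -> : pr (e 0%N) * f = 0; last by [].
  apply: eq_endo_pr => i y; rewrite endoM fT endo0E; apply: prT => k ->.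
  by rewrite -[next _]/(e k.+1) => /e_inj.
have prSf k : pr (e k.+1) (f x) = h (e k) (pr (e k) x).
  rewrite -!endoM; have -> // : pr (e k.+1) * f = h (e k) * pr (e k).
  apply: eq_endo_pr => i y; rewrite !endoM fT.
  have [->|/eqP ie] := eqVneq i (e k).
    rewrite Te pr_pr; have [_ hc _ _] := hP (e k).
    have [m ->] := hc (pr (e k) y).
    by rewrite raddfMz (pr_id dec).
  rewrite (pr_pr0 _ (nesym ie)) raddf0; apply: prT => l il.
  rewrite il -[next _]/(e l.+1) => /e_inj[kl]; by rewrite il kl in ie.
have x_chain k : exists2 m, pr (e k) x = c (e k) *~ m &
    ~ ((p ^ logn p (o (e k)))%N %| m)%Z.
  elim: k => [|k [m mE mN]].
    exists 1; first by rewrite xE raddfD pr0f addr0 (pr_id dec).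
    rewrite dvdz1 absz_nat gtn_eqF //; apply: (@leq_ltn_trans (p ^ 0)) => //.
    by rewrite ltn_exp2l ?prime_gt1 //; exact: leq_ltn_trans (nextP i0).
  have [_ _ _ hm] := hP (e k); have [m' m'E m'N] := hm m mN; exists m' => //.
  rewrite xE raddfD (pr_neq dec) ?add0r ?prSf ?mE // => /e_inj //.
(* The support of x would contain the whole chain. *)
have [S [_ S0 _]] := pr_supp dec x.
have eS k : e k \in S.
  apply/negP => /negP/S0 ek0; have [m mE mN] := x_chain k.
  by apply: mN; apply: dvdz_trans (_ : (o (e k) %| m)%Z);
    [exact: pfactor_dvdnn|apply/oP; rewrite -mE].
pose E := map e (iota 0 (size S).+1).
have uE : uniq E by rewrite map_inj_uniq ?iota_uniq.
have ES : {subset E <= S} by move=> _ /mapP[k _ ->].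
by have := uniq_leq_size uE ES; rewrite size_map size_iota ltnn.
Qed.

End Unbounded.

End Coordinates.

Theorem theorem3 (A : zmodType) (hA : direct_sum_of_cyclics A) :
  closed (jacobson_radical (endo A)) <->
  (forall p : nat, prime p -> bounded_subgroup (primary_component A p)).
Proof.
have [I [c [pr dec]]] := direct_sum_of_cyclicsP hA.
split=> [clJ p pp|]; last exact: (closed_jacobson_of_bounded dec).
have /choice[o oP] := fun i => int_order (c i).
have [N oN] := closed_jacobson_logn_bounded dec oP pp clJ.
exact: (bounded_of_logn dec oP pp oN).
Qed.
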